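(* Let $\mathbb{K}\in\{\mathbb{R},\mathbb{C}\}$ and let $\Sigma=(E,A,B,C,D)$ be a descriptor system over $\mathbb{K}$ with $(E,A)$ regular. Then (pH) holds if and only if (KYP) holds for some $Q\in\mathbb{K}^{n\times n}$ with $\ker Q\subseteq\ker C\cap\ker A$.
   Context: A descriptor system $\Sigma=(E,A,B,C,D)$ over $\mathbb{K}$ is given by $E,A\in\mathbb{K}^{n\times n}$, $B\in\mathbb{K}^{n\times m}$, $C\in\mathbb{K}^{m\times n}$, $D\in\mathbb{K}^{m\times m}$ and stands for $\tfrac{d}{dt}Ex=Ax+Bu$, $y=Cx+Du$. $(E,A)$ is regular if $\lambda E-A$ is invertible for some $\lambda\in\mathbb{C}$. $M^H$ is the conjugate transpose; $M\ge 0$ means Hermitian positive semidefinite. (pH): there exist $J,R,Q\in\mathbb{K}^{n\times n}$, $G,P\in\mathbb{K}^{n\times m}$, $S,N\in\mathbb{K}^{m\times m}$ with $$\begin{bmatrix}A&B\\C&D\end{bmatrix}=\begin{bmatrix}(J-R)Q&G-P\\(G+P)^HQ&S+N\end{bmatrix},\quad Q^HE=E^HQ\ge 0,$$ $$\Gamma:=\begin{bmatrix}J&G\\-G^H&N\end{bmatrix}=-\Gamma^H,\quad W:=\begin{bmatrix}Q^HRQ&Q^HP\\P^HQ&S\end{bmatrix}=W^H\ge 0.$$ (KYP) holds for $Q\in\mathbb{K}^{n\times n}$ if $$\begin{bmatrix}-A^HQ-Q^HA&C^H-Q^HB\\C-B^HQ&D+D^H\end{bmatrix}\ge 0,\qquad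 E^HQ=Q^HE\ge 0.$$ *)

(* Defs.v *)
From HB Require Import structures.
From mathcomp Require Import all_boot all_order all_algebra.
From mathcomp Require Import complex.
From mathcomp Require Import classical_sets reals.

Set Implicit Arguments.
Unset Strict Implicit.
Unset Printing Implicit Defensive.

Import Order.TTheory GRing.Theory Num.Theory.
Local Open Scope classical_set_scope.
Local Open Scope ring_scope.
Local Open Scope complex_scope.

Inductive ground := RealGround | ComplexGround.

(* The two possible base fields, so that one statement covers both; R[i] is the
   field of complex numbers over R. *)
Definition Kfield (R : realType) (k : ground) : numFieldType :=
  match k with
  | RealGround => R
  | ComplexGround => R[i]
  end.

Definition conjK (R : realType) (k : ground) : Kfield R k -> Kfield R k :=
  match k return Kfield R k -> Kfield R k with
  | RealGround => fun x => x
  | ComplexGround => fun z : R[i] => Num.conj z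
  end.

Definition toC (R : realType) (k : ground) : Kfield R k -> R[i] :=
  match k return Kfield R k -> R[i] with
  | RealGround => fun x : R => x%:C
  | ComplexGround => fun z => z
  end.

Arguments conjK {R k} _.
Arguments toC {R k} _.

Definition conjtrmx (R : realType) (k : ground) (p q : nat)
  (M : 'M[Kfield R k]_(p, q)) : 'M[Kfield R k]_(q, p) := map_mx conjK M^T.

Notation "M ^H" := (conjtrmx M) (at level 2, left associativity, format "M ^H").

(* On R[i] the relation 0 <= z means that z is real and nonnegative. *)
Definition psdmx (R : realType) (k : ground) (p : nat)
    (M : 'M[Kfield R k]_p) : Prop :=
  M = M^H /\
  forall x : 'cV[Kfield R k]_p, 0 <= (x^H *m M *m x) ord0 ord0.

(* Kernel of x |-> M x on column vectors; kermx is the kernel on row vectors. *)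
Definition colker (F : fieldType) (p q : nat) (M : 'M[F]_(p, q)) :
    set 'cV[F]_q := [set x | M *m x = 0].

Record descriptor_system (K : fieldType) (n m : nat) := DescriptorSystem {
  dsE : 'M[K]_n;
  dsA : 'M[K]_n;
  dsB : 'M[K]_(n, m);
  dsC : 'M[K]_(m, n);
  dsD : 'M[K]_m
}.

(* lambda is complex even when the matrices are real. *)
Definition regular_pair (R : realType) (k : ground) (n : nat)
    (E A : 'M[Kfield R k]_n) : Prop :=
  exists lambda : R[i], lambda *: map_mx toC E - map_mx toC A \in unitmx.

(* Rd is the dissipation matrix, the name R being taken by the real numbers. *)
Definition port_hamiltonian (R : realType) (k : ground) (n m : nat)
    (Sigma : descriptor_system (Kfield R k) n m) : Prop :=
  let: DescriptorSystem E A B C D := Sigma in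
  exists (J Rd Q : 'M[Kfield R k]_n) (G P : 'M[Kfield R k]_(n, m))
         (S N : 'M[Kfield R k]_m),
    let Gamma := block_mx J G (- G^H) N in
    let W := block_mx (Q^H *m Rd *m Q) (Q^H *m P) (P^H *m Q) S in
    [/\ block_mx A B C D =
          block_mx ((J - Rd) *m Q) (G - P) ((G + P)^H *m Q) (S + N),
        Q^H *m E = E^H *m Q /\ psdmx (Q^H *m E),
        Gamma = - Gamma^H
      & W = W^H /\ psdmx W].

Definition KYP (R : realType) (k : ground) (n m : nat)
    (Sigma : descriptor_system (Kfield R k) n m) (Q : 'M[Kfield R k]_n) : Prop :=
  let: DescriptorSystem E A B C D := Sigma in
  psdmx (block_mx (- (A^H *m Q) - Q^H *m A) (C^H - Q^H *m B)
                  (C - B^H *m Q)            (D + D^H)) /\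
  (E^H *m Q = Q^H *m E /\ psdmx (E^H *m Q)).

(* Main.v *)
(** For a representation [A = (J - R) Q], [B = G - P], [C = (G + P)^H Q],
    [D = S + N] with [J] and [N] skew-Hermitian, the KYP matrix equals
    [W + W^H]; so, for a Hermitian [W], it is positive semidefinite iff [W] is.
    Conversely, the kernel inclusion lets one factor [A = X Q] and [C = Y Q];
    [J - R] and [S + N] are then the splittings of [X] and [D] into
    skew-Hermitian and Hermitian parts, while [G - P = B] and [G + P = Y^H]
    determine [G] and [P]. *)
Require Import Defs.
From HB Require Import structures.
From mathcomp Require Import all_boot all_order all_algebra.
From mathcomp Require Import complex.
From mathcomp Require Import classical_sets reals.
Import Order.TTheory GRing.Theory Num.Theory.
Local Open Scope classical_set_scope.
Local Open Scope ring_scope.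

(** Together with multiplicativity, this makes [conjK] a ring morphism over both fields at once, so
    the [map_mx] lemmas apply without a case split. *)
Lemma conjK_is_zmod_morphism (R : realType) (k : ground) :
  zmod_morphism (@conjK R k).
Proof. by case: k => x y //=; rewrite rmorphB. Qed.

Lemma conjK_is_monoid_morphism (R : realType) (k : ground) :
  monoid_morphism (@conjK R k).
Proof. by case: k; split=> [|x y] //=; rewrite ?rmorph1 ?rmorphM. Qed.

HB.instance Definition _ (R : realType) (k : ground) :=
  GRing.isZmodMorphism.Build (Kfield R k) (Kfield R k) (@conjK R k)
    (@conjK_is_zmod_morphism R k).
HB.instance Definition _ (R : realType) (k : ground) :=
  GRing.isMonoidMorphism.Build (Kfield R k) (Kfield R k) (@conjK R k)
    (@conjK_is_monoid_morphism R k).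

Lemma conjKK (R : realType) (k : ground) : involutive (@conjK R k).
Proof. by case: k => x //=; rewrite conjCK. Qed.

Section ConjugateTranspose.
Context {R : realType} {k : ground}.
Local Notation K := (Kfield R k).

Lemma conjtrmxK p q (M : 'M[K]_(p, q)) : M^H^H = M.
Proof. by apply/matrixP=> i j; rewrite !mxE conjKK. Qed.

Lemma conjtrmxD p q (M L : 'M[K]_(p, q)) : (M + L)^H = M^H + L^H.
Proof. by rewrite /conjtrmx linearD map_mxD. Qed.

Lemma conjtrmxN p q (M : 'M[K]_(p, q)) : (- M)^H = - M^H.
Proof. by rewrite /conjtrmx linearN map_mxN. Qed.

Lemma conjtrmxM p q r (M : 'M[K]_(p, q)) (L : 'M[K]_(q, r)) :
  (M *m L)^H = L^H *m M^H.
Proof. by rewrite /conjtrmx trmx_mul map_mxM. Qed.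

(** Ring morphisms fix one half; a general scalar would come out conjugated. *)
Lemma conjtrmxZ_half p q (M : 'M[K]_(p, q)) : (2^-1 *: M)^H = 2^-1 *: M^H.
Proof. by rewrite /conjtrmx linearZ map_mxZ fmorphV rmorph_nat. Qed.

Lemma conjtrmx_block p1 p2 q1 q2
    (Mul : 'M[K]_(p1, q1)) (Mur : 'M_(p1, q2))
    (Mdl : 'M_(p2, q1)) (Mdr : 'M_(p2, q2)) :
  (block_mx Mul Mur Mdl Mdr)^H = block_mx Mul^H Mdl^H Mur^H Mdr^H.
Proof. by rewrite /conjtrmx tr_block_mx map_block_mx. Qed.

Lemma half_addmx p q (M : 'M[K]_(p, q)) : 2^-1 *: (M + M) = M.
Proof. by rewrite -mulr2n -scaler_nat scalerA mulVf ?scale1r ?pnatr_eq0. Qed.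

Definition hermpart {p} (M : 'M[K]_p) := 2^-1 *: (M + M^H).
Definition skewpart {p} (M : 'M[K]_p) := 2^-1 *: (M - M^H).

Lemma hermpartP p (M : 'M[K]_p) : (hermpart M)^H = hermpart M.
Proof. by rewrite conjtrmxZ_half conjtrmxD conjtrmxK addrC. Qed.

Lemma skewpartP {p} (M : 'M[K]_p) : skewpart M = - (skewpart M)^H.
Proof.
by rewrite conjtrmxZ_half conjtrmxD conjtrmxN conjtrmxK -scalerN opprD opprK addrC.
Qed.

Lemma hermpartD_skewpart {p} (M : 'M[K]_p) : hermpart M + skewpart M = M.
Proof. by rewrite -scalerDr addrACA subrr addr0 half_addmx. Qed.

(** Absorbs the factor two that arises when [W + W^H] collapses to [W + W] for a Hermitian [W]. *)
Lemma psdmx_double p (M : 'M[K]_p) : M = M^H -> psdmx (M + M) <-> psdmx M.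
Proof.
move=> hM; rewrite /psdmx conjtrmxD -hM.
have formD x : (x^H *m (M + M) *m x) ord0 ord0
             = (x^H *m M *m x) ord0 ord0 *+ 2.
  by rewrite mulmxDr mulmxDl mxE.
by split=> -[_ M0]; split=> // x; move: (M0 x); rewrite formD pmulrn_lge0.
Qed.

(** The skew-Hermitian [J] and [N] cancel on the diagonal and [G] cancels off it, so only [Rd], [P]
    and [S] survive. Since [Rd] and [S] are arbitrary here, the second summand is [W^H] and not
    [W]. *)
Lemma KYP_matrixE {n m} (J Rd Q : 'M[K]_n) (G P : 'M_(n, m)) (S N : 'M_m) :
  J = - J^H -> N = - N^H ->
  let A := (J - Rd) *m Q in
  let B := G - P in
  let C := (G + P)^H *m Q in
  let D := S + N in
  let W := block_mx (Q^H *m Rd *m Q) (Q^H *m P) (P^H *m Q) S in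
  block_mx (- (A^H *m Q) - Q^H *m A) (C^H - Q^H *m B)
           (C - B^H *m Q) (D + D^H) = W + W^H.
Proof.
move=> hJ hN /=; rewrite conjtrmx_block add_block_mx.
have {}hJ : J^H = - J by rewrite [in RHS]hJ opprK.
have {}hN : N^H = - N by rewrite [in RHS]hN opprK.
congr block_mx; rewrite !(conjtrmxM, conjtrmxD, conjtrmxN, conjtrmxK, hJ, hN).
- rewrite !mulmxA -opprD -!mulmxDl -mulmxDr -mulmxDr -mulNmx -mulmxN.
  by congr (_ *m _ *m _); rewrite addrACA addNr add0r -opprD opprK addrC.
- by rewrite -mulmxBr -mulmxDr opprD opprK addrACA subrr add0r.
- by rewrite -mulmxBl -mulmxDl opprD opprK addrACA subrr add0r.
- by rewrite addrACA subrr addr0.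
Qed.

End ConjugateTranspose.

(** The columns of [cokermx M] lie in the kernel of [M], hence in that of [L], so
    [L *m cokermx M = 0]. By [submxE] this says that the row space of [L] lies in that of [M]. *)
Lemma colker_factor (F : fieldType) (p q r : nat)
    (M : 'M[F]_(p, q)) (L : 'M[F]_(r, q)) :
  colker M `<=` colker L -> exists X, L = X *m M.
Proof.
move=> kerML; apply/submxP; rewrite submxE; apply/eqP/matrixP=> i j.
have /(kerML _)/matrixP/(_ i ord0) : colker M (col j (cokermx M)).
  by rewrite /colker /= colE mulmxA mulmx_coker mul0mx.
by rewrite colE mulmxA -colE !mxE.
Qed.

Theorem proposition3p3 (R : realType) (k : ground) (n m : nat)
    (Sigma : descriptor_system (Kfield R k) n m) :
  regular_pair (dsE Sigma) (dsA Sigma) ->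
  (port_hamiltonian Sigma <->
   exists Q : 'M[Kfield R k]_n,
     KYP Sigma Q /\
     colker Q `<=` colker (dsC Sigma) `&` colker (dsA Sigma)).
Proof.
case: Sigma => E A B C D _; split.
- move=> [J [Rd [Q [G [P [S [N []]]]]]]].
  move=> /eq_block_mx[-> -> -> ->] [QE psdQE].
  rewrite conjtrmx_block opp_block_mx => /eq_block_mx[hJ _ _ hN] [hW psdW].
  exists Q; split; last first.
    (* Both [C] and [A] have [Q] as a right factor. *)
    by move=> x /= Qx0; split; rewrite /colker /= -mulmxA Qx0 mulmx0.
  rewrite /KYP KYP_matrixE //; split; last by rewrite -QE.
  by rewrite -hW; apply/psdmx_double.
- move=> [Q [[psdK [EQ psdEQ]] kerQ]].
  have [X XQ] : exists X, A = X *m Q.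
    by apply: colker_factor => x /kerQ[].
  have [Y YQ] : exists Y, C = Y *m Q.
    by apply: colker_factor => x /kerQ[].
  pose G := 2^-1 *: (Y^H + B); pose P := 2^-1 *: (Y^H - B).
  (* [X] plays the part of [J - Rd], so the witness for [Rd] is minus the Hermitian part of [X]. *)
  have XE : X = skewpart X - - hermpart X.
    by rewrite opprK addrC hermpartD_skewpart.
  have BE : B = G - P.
    by rewrite -scalerBr opprD opprK addrACA subrr add0r half_addmx.
  have YE : Y = (G + P)^H.
    by rewrite -scalerDr addrACA subrr addr0 half_addmx conjtrmxK.
  have DE := esym (hermpartD_skewpart D).
  exists (skewpart X), (- hermpart X), Q, G, P, (hermpart D), (skewpart D).
  move=> Gamma W.
  (* The diagonal blocks are Hermitian because [Rd] and [S] are built from Hermitian parts; the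
     off-diagonal blocks are conjugate transposes of each other. *)
  have hW : W = W^H.
    by rewrite conjtrmx_block !conjtrmxM conjtrmxN !hermpartP !conjtrmxK !mulmxA.
  split.
  + by rewrite -XE -XQ -BE -YE -YQ -DE.
  + by rewrite -EQ.
  + rewrite conjtrmx_block opp_block_mx -!skewpartP.
    by rewrite conjtrmxN conjtrmxK opprK.
  + split=> //; apply/psdmx_double => //.
    (* Only the second summand changes: [W + W] becomes [W + W^H], which [KYP_matrixE] turns back
       into the matrix of [psdK]. *)
    rewrite [X in _ + X]hW.
    rewrite -(KYP_matrixE _ _ _ G _ _ _ (skewpartP X) (skewpartP D)).
    by rewrite -XE -XQ -BE -YE -YQ -DE.
Qed.
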